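(* For every $n\ge 1$, $|\mathfrak{S}_n(132,\mathrm{D})|=C_{n-1}$.
   Context: $C_n=\frac{1}{n+1}\binom{2n}{n}$ is the $n$-th Catalan number. $\mathfrak{S}_n$ is the set of permutations $\sigma=\sigma_1\sigma_2\cdots\sigma_n$ of $[n]=\{1,\dots,n\}$ in one-line notation. A mesh pattern is a pair $p=(\pi,R)$ with $\pi\in\mathfrak{S}_m$ and $R\subseteq\{0,\dots,m\}\times\{0,\dots,m\}$ (the set of shaded unit cells, each given by its bottom-left corner, in the grid with dots at $(i,\pi_i)$). An occurrence of $p$ in $\sigma\in\mathfrak{S}_n$ is a choice of indices $i_1<\cdots<i_m$ such that $\sigma_{i_1}\cdots\sigma_{i_m}$ is order-isomorphic to $\pi$ and, for every $(a,b)\in R$, there is no index $r$ with $i_a<r<i_{a+1}$ and $v_b<\sigma_r<v_{b+1}$; here $v_1<\cdots<v_m$ is the increasing rearrangement of $\sigma_{i_1},\dots,\sigma_{i_m}$, $i_0=v_0=0$ and $i_{m+1}=v_{m+1}=n+1$. A classical pattern $\pi$ is the mesh pattern $(\pi,\varnothing)$. $\mathfrak{S}_n(p,q)$ is the set of permutations in $\mathfrak{S}_n$ with no occurrence of $p$ and no occurrence of $q$. Here $132$ is the classical pattern and $\mathrm{D}=(21,\{(0,0),(2,2)\})$. *)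

(* Defs.v *)
From mathcomp Require Import all_boot all_fingroup.

Set Implicit Arguments.
Unset Strict Implicit.
Unset Printing Implicit Defensive.

(* Permutations of [n] = {1, ..., n} are elements of 'S_n, the permutations of
   {0, ..., n - 1}: the (i + 1)-st entry of the one-line word is (s i).+1. *)
Definition one_line (n : nat) (s : 'S_n) : seq nat :=
  [seq (s i).+1 | i <- enum 'I_n].

(* The division is exact. *)
Definition catalan (n : nat) : nat := 'C(2 * n, n) %/ n.+1.

Record mesh_pattern (m : nat) := MeshPattern {
  mesh_perm : 'S_m;
  mesh_shading : {set 'I_m.+1 * 'I_m.+1}
}.

Definition classical (m : nat) (p : 'S_m) : mesh_pattern m :=
  MeshPattern p set0.

(* In what follows, f j is the (j + 1)-st chosen index, shifted down by one. *)
Definition increasing (m n : nat) (f : {ffun 'I_m -> 'I_n}) : bool :=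
  [forall j : 'I_m, forall k : 'I_m, (j < k) ==> (f j < f k)].

Definition order_isomorphic (m n : nat) (pi : 'S_m) (s : 'S_n)
    (f : {ffun 'I_m -> 'I_n}) : bool :=
  [forall j : 'I_m, forall k : 'I_m, (s (f j) < s (f k)) == (pi j < pi k)].

(* The sequences i_0, ..., i_(m+1) and v_0, ..., v_(m+1) of the grid lines,
   in 1-based coordinates, with i_0 = v_0 = 0 and i_(m+1) = v_(m+1) = n + 1. *)
Definition grid_cols (m n : nat) (f : {ffun 'I_m -> 'I_n}) : seq nat :=
  0 :: rcons [seq (f j).+1 | j <- enum 'I_m] n.+1.

Definition grid_rows (m n : nat) (s : 'S_n) (f : {ffun 'I_m -> 'I_n}) :
    seq nat :=
  0 :: rcons (sort leq [seq (s (f j)).+1 | j <- enum 'I_m]) n.+1.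

Definition cell_empty (m n : nat) (s : 'S_n) (f : {ffun 'I_m -> 'I_n})
    (a b : nat) : bool :=
  ~~ [exists r : 'I_n,
        (nth 0 (grid_cols f) a < r.+1 < nth 0 (grid_cols f) a.+1) &&
        (nth 0 (grid_rows s f) b < (s r).+1 < nth 0 (grid_rows s f) b.+1)].

Definition occurrence (m n : nat) (p : mesh_pattern m) (s : 'S_n)
    (f : {ffun 'I_m -> 'I_n}) : bool :=
  [&& increasing f, order_isomorphic (mesh_perm p) s f
    & [forall c in mesh_shading p, cell_empty s f c.1 c.2]].

Definition avoids (m n : nat) (p : mesh_pattern m) (s : 'S_n) : bool :=
  ~~ [exists f : {ffun 'I_m -> 'I_n}, occurrence p s f].

Definition avoiders2 (n m1 m2 : nat)
    (p : mesh_pattern m1) (q : mesh_pattern m2) : {set 'S_n} :=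
  [set s | avoids p s && avoids q s].

Definition perm132 : 'S_3 := tperm (inord 1) (inord 2).

Definition perm21 : 'S_2 := tperm ord0 ord_max.

Lemma one_line_perm132 : one_line perm132 = [:: 1; 3; 2].
Proof.
rewrite /one_line !enum_ordSl enum_ord0 /= /perm132 !permE /=.
by rewrite -!val_eqE /= !inordK.
Qed.

Lemma one_line_perm21 : one_line perm21 = [:: 2; 1].
Proof. by rewrite /one_line !enum_ordSl enum_ord0 /= /perm21 !permE. Qed.

Definition pattern132 : mesh_pattern 3 := classical perm132.

Definition patternD : mesh_pattern 2 :=
  MeshPattern perm21 [set (ord0, ord0); (ord_max, ord_max)].

(* Main.v *)
Require Import Defs.
From mathcomp Require Import all_boot all_fingroup.
From mathcomp Require Import zify.

(** Two observations reduce the count to a classical one.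

    In a permutation that avoids 132, the entries before the maximum all exceed
    the entries after it.  Hence, if the maximum is not the last entry, then
    the maximum and the last entry form an occurrence of D: nothing exceeds
    the maximum, and an earlier entry below the last one would complete a 132.
    Conversely, if the maximum is the last entry, it lies in the upper right
    cell of every inversion, so D is avoided.  Thus the avoiders of both
    patterns of length n + 1 are the 132-avoiders with the maximum last
    ([avoids_132_D_max_last]), and deleting it leaves an arbitrary 132-avoider
    of length n ([avoids132_lift_max]).

    The 132-avoiders are counted by removing the first entry.  If that entry
    has value b, the rest avoids 132 and its entries above b increase.  So one
    counts, more finely and with values 0, ..., n - 1, the 132-avoiders of
    length n whose entries of value at least a increase; the first entry is then
    at most a, and the counts N(n, a) satisfy
    N(n + 1, a) = sum over b <= min (a, n) of N(n, b)
    ([card_tail_avoidersS]).  This is the recurrence of the ballot numbers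
    C(n + a, n) - C(n + a, n + 1) ([card_tail_avoiders_ballot]), whose diagonal
    a = n is the Catalan sequence. *)

Set Implicit Arguments.
Unset Strict Implicit.
Unset Printing Implicit Defensive.

(** * The two patterns in terms of the entries *)

Definition occurs132 n (s : 'S_n) (i j k : 'I_n) : bool :=
  [&& i < j, j < k, s i < s k & s k < s j].

Definition occursD n (s : 'S_n) (i j : 'I_n) : Prop :=
  [/\ i < j, s j < s i, forall r : 'I_n, r < i -> s j < s r
    & forall r : 'I_n, j < r -> s r < s i].

Lemma avoids132P n (s : 'S_n) :
  reflect (forall i j k, ~~ occurs132 s i j k) (avoids pattern132 s).
Proof.
pose o0 : 'I_3 := ord0; pose o1 : 'I_3 := inord 1; pose o2 : 'I_3 := inord 2.
have v1 : (o1 : nat) = 1 by rewrite inordK.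
have v2 : (o2 : nat) = 2 by rewrite inordK.
have I3 (x : 'I_3) : [\/ x = o0, x = o1 | x = o2].
  case: x => [[|[|[|//]]] lt_x3]; [constructor 1 | constructor 2 | constructor 3];
    by apply: val_inj; rewrite /= ?inordK.
have p0 : perm132 o0 = o0 by rewrite tpermD // -val_eqE /= inordK.
have p1 : perm132 o1 = o2 by rewrite tpermL.
have p2 : perm132 o2 = o1 by rewrite tpermR.
rewrite /avoids; apply: (iffP existsPn) => [noc i j k | noc f].
  apply/negP => /and4P[ij jk ik kj].
  pose f : {ffun 'I_3 -> 'I_n} := [ffun x : 'I_3 => nth i [:: i; j; k] x].
  have f0 : f o0 = i by rewrite ffunE.
  have f1 : f o1 = j by rewrite ffunE v1.
  have f2 : f o2 = k by rewrite ffunE v2.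
  case/negP: (noc f); apply/and3P; split.
  - apply/forallP => x; apply/forallP => y.
    case: (I3 x) => ->; case: (I3 y) => ->; rewrite ?f0 ?f1 ?f2 ?v1 ?v2 //=; lia.
  - apply/forallP => x; apply/forallP => y.
    case: (I3 x) => ->; case: (I3 y) => ->;
      rewrite /= ?p0 ?p1 ?p2 ?f0 ?f1 ?f2 ?v1 ?v2 //=; lia.
  - by apply/forallP => c; rewrite inE.
apply/negP => /and3P[/forallP inc /forallP iso _].
case/negP: (noc (f o0) (f o1) (f o2)).
move: (inc o0) (inc o1) => /forallP/(_ o1) + /forallP/(_ o2).
move: (iso o0) (iso o2) => /forallP/(_ o2) + /forallP/(_ o1).
rewrite /= p0 p1 p2 v1 v2 /= => /eqP i02 /eqP i21 /= i01 i12.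
by apply/and4P.
Qed.

(** The shaded cells are open, whereas the bounds in [occursD] also rule out
    r = j on the left of i and r = i on the right of j; as i < j, neither can
    arise. *)
Lemma avoidsDP n (s : 'S_n) :
  reflect (forall i j, ~ occursD s i j) (avoids patternD s).
Proof.
pose o0 : 'I_2 := ord0; pose o1 : 'I_2 := ord_max.
have I2 (x : 'I_2) : x = o0 \/ x = o1.
  by case: x => [[|[|//]] lt_x2]; [left | right]; apply: val_inj.
have p0 : perm21 o0 = o1 by rewrite tpermL.
have p1 : perm21 o1 = o0 by rewrite tpermR.
have cols (f : {ffun 'I_2 -> 'I_n}) :
    grid_cols f = [:: 0; (f o0).+1; (f o1).+1; n.+1].
  rewrite /grid_cols !enum_ordSl (enum_ord0) /=.
  by congr [:: _; _; (f _).+1; _]; apply: val_inj.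
have rows (f : {ffun 'I_2 -> 'I_n}) : s (f o1) < s (f o0) ->
    grid_rows s f = [:: 0; (s (f o1)).+1; (s (f o0)).+1; n.+1].
  move=> lt10; rewrite /grid_rows !enum_ordSl enum_ord0 /=.
  have -> : lift ord0 ord0 = o1 by apply: val_inj.
  have -> : sort leq [:: (s (f o0)).+1; (s (f o1)).+1]
      = [:: (s (f o1)).+1; (s (f o0)).+1].
    by rewrite sortE /= ltnS leqNgt lt10.
  by [].
rewrite /avoids; apply: (iffP existsPn) => [noc i j [ij ji lo hi] | noc f].
  pose f : {ffun 'I_2 -> 'I_n} := [ffun x : 'I_2 => nth i [:: i; j] x].
  have f0 : f o0 = i by rewrite ffunE.
  have f1 : f o1 = j by rewrite ffunE.
  case/negP: (noc f); apply/and3P; split.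
  - apply/forallP => x; apply/forallP => y.
    by case: (I2 x) => ->; case: (I2 y) => ->; rewrite ?f0 ?f1 //= ltnn.
  - apply/forallP => x; apply/forallP => y.
    case: (I2 x) => ->; case: (I2 y) => ->; rewrite /= ?p0 ?p1 ?f0 ?f1 //=; lia.
  - apply/forall_inP => c; rewrite !inE.
    have lt10 : s (f o1) < s (f o0) by rewrite f0 f1.
    case/orP => /eqP->; rewrite /cell_empty cols (rows _ lt10) f0 f1 /=;
      apply/existsPn => r; apply/negP => /=.
    + by have := lo r; lia.
    + by have := hi r; have := ltn_ord r; have := ltn_ord (s r); lia.
apply/negP => /and3P[/forallP inc /forallP iso /forall_inP shade].
move: (inc o0) (iso o1) => /forallP/(_ o1) /= i01 /forallP/(_ o0).
rewrite /= p0 p1 /= => /eqP lt10.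
apply: (noc (f o0) (f o1)); split=> // r.
- move=> r0; rewrite ltnNge; apply/negP => le_r.
  have:= shade (ord0, ord0); rewrite !inE eqxx => /(_ isT).
  rewrite /cell_empty cols rows //= => /existsPn/(_ r)/negP; apply.
  rewrite !ltnS r0 ltn_neqAle le_r andbT; apply/eqP => /val_inj/perm_inj e.
  by rewrite e ltnNge (ltnW i01) in r0.
- move=> r1; rewrite ltnNge; apply/negP => le_r.
  have:= shade (ord_max, ord_max); rewrite !inE eqxx orbT => /(_ isT).
  rewrite /cell_empty cols rows //= => /existsPn/(_ r)/negP; apply.
  rewrite !ltnS !ltn_ord !andbT r1 ltn_neqAle le_r andbT.
  by apply/eqP => /val_inj/perm_inj e; rewrite -e ltnNge (ltnW i01) in r1.
Qed.

(** * Deleting one entry *)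

Lemma lift_perm_inj n (i j : 'I_n.+1) : injective (@lift_perm n i j).
Proof.
move=> s t eq_st; apply/permP => k; apply: (@lift_inj _ j).
by rewrite -!(lift_perm_lift i) eq_st.
Qed.

Lemma lift_perm_surj n (i : 'I_n.+1) (s : 'S_n.+1) :
  exists t : 'S_n, s = lift_perm i (s i) t.
Proof.
pose f (k : 'I_n) := odflt k (unlift (s i) (s (lift i k))).
have fK k : lift (s i) (f k) = s (lift i k).
  rewrite /f; case: unliftP => // /perm_inj e.
  by have := neq_lift i k; rewrite e eqxx.
have inj_f : injective f.
  by move=> k l /(congr1 (lift (s i))); rewrite !fK => /perm_inj/lift_inj.
exists (perm inj_f); apply/permP => k.
by case: (unliftP i k) => [l|] ->; rewrite ?lift_perm_id // lift_perm_lift permE fK.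
Qed.

Lemma card_lift_perm n (P : pred 'S_n.+1) (i j : 'I_n.+1) :
  #|[set s | P s & s i == j]| = #|[set t : 'S_n | P (lift_perm i j t)]|.
Proof.
rewrite -(card_imset _ (@lift_perm_inj n i j)); apply: eq_card => s.
rewrite inE; apply/andP/imsetP => [[Ps /eqP <-] | [t + ->]].
  by have [t e] := lift_perm_surj i s; exists t; rewrite ?inE -?e.
by rewrite inE lift_perm_id.
Qed.

Lemma ltn_lift n (i : 'I_n.+1) (x y : 'I_n) : (lift i x < lift i y) = (x < y).
Proof. by rewrite /= !ltnNge leq_bump2. Qed.

Lemma occurs132_lift n (a b : 'I_n.+1) (t : 'S_n) i j k :
  occurs132 (lift_perm a b t) (lift a i) (lift a j) (lift a k)
  = occurs132 t i j k.
Proof. by rewrite /occurs132 !lift_perm_lift !ltn_lift. Qed.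

(** * The avoiders of both patterns *)

Lemma ltn_ord_max n (i : 'I_n.+1) : (i < (ord_max : 'I_n.+1)) = (i != ord_max).
Proof. by rewrite ltn_neqAle -ltnS ltn_ord andbT. Qed.

Lemma avoids_132_D_max_last n (s : 'S_n.+1) :
  avoids pattern132 s ->
  avoids patternD s = (s ord_max == ord_max).
Proof.
move/avoids132P=> av; apply/avoidsDP/eqP => [noD | last_max i j [ij ji _ hi]].
  apply/eqP/negPn/negP => last_lt.
  pose i : 'I_n.+1 := (s^-1)%g ord_max.
  have si : s i = ord_max by rewrite permKV.
  have below r : r != i -> s r < s i.
    by move=> ri; rewrite si ltn_ord_max -si (inj_eq perm_inj).
  have last_i : (ord_max : 'I_n.+1) != i.
    by apply/eqP => e; move: last_lt; rewrite {1}e si eqxx.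
  have i_lt : i < (ord_max : 'I_n.+1) by rewrite ltn_ord_max eq_sym.
  apply: (noD i ord_max); split=> //.
  - exact: below.
  - move=> r ri; have := av r i ord_max.
    rewrite /occurs132 ri i_lt (below _ last_i) andbT /= -leqNgt leq_eqVlt.
    case/orP => [/eqP/val_inj/perm_inj e | //].
    by move: ri; rewrite -e ltnNge (ltnW i_lt).
  - by move=> r; rewrite ltnNge -ltnS ltn_ord.
have j_lt : j < (ord_max : 'I_n.+1).
  rewrite ltn_ord_max; apply/eqP => e.
  by move: ji; rewrite e last_max ltnNge -ltnS ltn_ord.
by have := hi _ j_lt; rewrite last_max ltnNge -ltnS ltn_ord.
Qed.

Lemma avoids132_lift_max n (t : 'S_n) :
  avoids pattern132 (lift_perm ord_max ord_max t) = avoids pattern132 t.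
Proof.
apply/avoids132P/avoids132P => av i j k; first by rewrite -(occurs132_lift ord_max ord_max).
apply/negP => occ; have /and4P[ij jk ik kj] := occ.
(* The last entry is the maximum, so it is not the 2 of a 132. *)
case: (unliftP ord_max k) => [k' ek | ek]; last first.
  by move: kj; rewrite ek lift_perm_id ltnNge -ltnS ltn_ord.
case: (unliftP ord_max j) => [j' ej | ej]; last first.
  by move: jk; rewrite ej ltnNge -ltnS ltn_ord.
case: (unliftP ord_max i) => [i' ei | ei]; last first.
  by move: ij; rewrite ei ltnNge -ltnS ltn_ord.
by case/negP: (av i' j' k'); rewrite -(occurs132_lift ord_max ord_max) -ei -ej -ek.
Qed.

(** * Counting the 132-avoiders *)

Definition increasing_from n (a : nat) (s : 'S_n) : bool :=
  [forall i : 'I_n, forall j : 'I_n,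
     [&& i < j, a <= s i & a <= s j] ==> (s i < s j)].

Lemma increasing_fromP n a (s : 'S_n) :
  reflect (forall i j : 'I_n, i < j -> a <= s i -> a <= s j -> s i < s j)
          (increasing_from a s).
Proof.
apply: (iffP forallP) => [inc i j ij ai aj | inc i].
  by move/forallP/(_ j)/implyP: (inc i); apply; apply/and3P.
by apply/forallP => j; apply/implyP => /and3P[]; apply: inc.
Qed.

(** The first entry can only play the 1 of a 132, and it does so exactly when
    some two entries above it are in decreasing order. *)
Lemma avoids132_lift_first n (b : 'I_n.+1) (t : 'S_n) :
  avoids pattern132 (lift_perm ord0 b t)
  = avoids pattern132 t && increasing_from b t.
Proof.
have above x : (b < lift b x) = (b <= x).
  by rewrite /= /bump; case: leqP => ?; lia.
apply/avoids132P/andP => [av | [/avoids132P av /increasing_fromP inc] i j k].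
  split; first by apply/avoids132P => i j k; rewrite -(occurs132_lift ord0 b).
  apply/increasing_fromP => i j ij ai aj.
  have := av ord0 (lift ord0 i) (lift ord0 j).
  rewrite /occurs132 lift_perm_id !lift_perm_lift !ltn_lift above ij aj /=.
  rewrite -leqNgt leq_eqVlt => /orP[/eqP/val_inj/perm_inj e | //].
  by rewrite e ltnn in ij.
apply/negP => occ; have /and4P[ij jk ik kj] := occ.
case: (unliftP ord0 j) => [j' ej | ej]; last by rewrite ej in ij.
case: (unliftP ord0 k) => [k' ek | ek]; last by rewrite ek in jk.
case: (unliftP ord0 i) => [i' ei | ei].
  by case/negP: (av i' j' k'); rewrite -(occurs132_lift ord0 b) -ei -ej -ek.
move: jk ik kj; rewrite ei ej ek lift_perm_id !lift_perm_lift !ltn_lift above.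
move=> jk bk kj; have := inc j' k' jk (leq_trans bk (ltnW kj)) bk.
by rewrite ltnNge (ltnW kj).
Qed.

(** If a < b, the value a occurs after the first entry b and breaks the
    increase; if a = b, the first entry is below all later ones that count. *)
Lemma increasing_from_lift_first n a (b : 'I_n.+1) (t : 'S_n) :
  increasing_from b t ->
  increasing_from a (lift_perm ord0 b t) = (b <= a).
Proof.
move=> /increasing_fromP inc; apply/increasing_fromP/idP => [inc' | ba i j ij].
  rewrite leqNgt; apply/negP => ab.
  have lt_an : a < n by have := ltn_ord b; lia.
  pose k := (t^-1)%g (Ordinal lt_an).
  have := inc' ord0 (lift ord0 k) isT; rewrite lift_perm_id lift_perm_lift permKV.
  rewrite /= /bump; lia.
case: (unliftP ord0 j) => [j' ej | ej]; last by rewrite ej in ij.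
case: (unliftP ord0 i) => [i' ei | ei].
  rewrite ei ej !lift_perm_lift ltn_lift => ai aj; apply: inc.
  - by rewrite ei ej ltn_lift in ij.
  - by move: ai; rewrite /= /bump; lia.
  - by move: aj; rewrite /= /bump; lia.
rewrite ei ej lift_perm_id lift_perm_lift /= /bump; lia.
Qed.

Definition tail_avoiders n a : {set 'S_n} :=
  [set s | avoids pattern132 s & increasing_from a s].

Lemma card_tail_avoidersS n a :
  #|tail_avoiders n.+1 a| = \sum_(b < n.+1 | b <= a) #|tail_avoiders n b|.
Proof.
have part : #|tail_avoiders n.+1 a|
    = \sum_(b < n.+1) #|[set s in tail_avoiders n.+1 a | s ord0 == b]|.
  rewrite -sum1_card (partition_big (fun s : 'S_n.+1 => s ord0) predT) //=.
  by apply: eq_bigr => b _; rewrite -sum1_card; apply: eq_bigl => s; rewrite inE.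
rewrite part [RHS]big_mkcond /=; apply: eq_bigr => b _.
rewrite (card_lift_perm (mem (tail_avoiders n.+1 a))).
have -> : [set t : 'S_n | mem (tail_avoiders n.+1 a) (lift_perm ord0 b t)]
    = if b <= a then tail_avoiders n b else set0.
  apply/setP => t; rewrite inE /= inE avoids132_lift_first.
  case: (boolP (increasing_from b t)) => [inc | ninc].
    by rewrite (increasing_from_lift_first a inc) andbT; case: ifP => _;
      rewrite !inE ?inc ?andbT ?andbF.
  by rewrite andbF; case: ifP => _; rewrite !inE ?(negPf ninc) ?andbF.
by case: ifP; rewrite ?cards0.
Qed.

Lemma tail_avoiders_ge n a : n <= a ->
  tail_avoiders n a = [set s | avoids pattern132 s].
Proof.
move=> le_na; apply/setP => s; rewrite !inE; case: (avoids _ _) => //=.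
by apply/increasing_fromP => i j _ ai; have := ltn_ord (s i); lia.
Qed.

Lemma card_tail_avoiders0 : #|tail_avoiders 0 0| = 1.
Proof.
rewrite tail_avoiders_ge // -[RHS](cards1 (1%g : 'S_0)); apply: eq_card => s.
rewrite !inE; have -> : s = 1%g by apply/permP; case.
by rewrite eqxx; apply/avoids132P; case.
Qed.

(** Written additively, since the ballot number is a difference of
    binomials; by reflection, C(n + a, n + 1) counts the lattice paths from the
    origin to (n, a) that cross the diagonal. *)
Lemma card_tail_avoiders_ballot n a : a <= n ->
  #|tail_avoiders n a| + 'C(n + a, n.+1) = 'C(n + a, n).
Proof.
elim: n a => [|n IHn] a; first by case: a => // _; rewrite card_tail_avoiders0.
elim: a => [_ | a IHa lt_an].
  rewrite card_tail_avoidersS (big_pred1 ord0) => [|b]; last by rewrite leqn0.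
  by have := IHn 0 (leq0n _); rewrite !addn0 !binn !bin_small.
have := IHa (ltnW lt_an); rewrite addnS !(binS (n.+1 + a)).
move: lt_an; rewrite ltnS leq_eqVlt orbC => /orP[lt_an | /eqP eq_an].
  have -> : #|tail_avoiders n.+1 a.+1|
      = #|tail_avoiders n a.+1| + #|tail_avoiders n.+1 a|.
    have lt_an1 : a.+1 < n.+1 by [].
    rewrite !card_tail_avoidersS (bigD1 (Ordinal lt_an1)) //=; congr (_ + _).
    by apply: eq_bigl => b; rewrite -val_eqE /=; lia.
  by have := IHn a.+1 lt_an; rewrite addnS -addSn; lia.
(* At a = n, raising the threshold changes nothing, and the two middle binomials
   of order 2n + 1 agree. *)
have -> : #|tail_avoiders n.+1 a.+1| = #|tail_avoiders n.+1 a|.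
  rewrite !card_tail_avoidersS; apply: eq_bigl => b.
  by have := ltn_ord b; rewrite eq_an; lia.
have : 'C(n.+1 + a, n) = 'C(n.+1 + a, n.+1).
  by rewrite eq_an -bin_sub ?leq_addl // addnK.
lia.
Qed.

Lemma card_avoiders132 n : #|[set s : 'S_n | avoids pattern132 s]| = catalan n.
Proof.
have := card_tail_avoiders_ballot (leqnn n).
rewrite tail_avoiders_ge // addnn -mul2n /catalan => ballot.
have := mul_bin_left (2 * n) n; rewrite mul2n -addnn addnK addnn -mul2n => left.
rewrite -ballot in left *.
set N := #|_| in ballot left *.
have -> : N + 'C(2 * n, n.+1) = N * n.+1 by nia.
by rewrite mulnK.
Qed.

Theorem theorem4p4 (n : nat) (hn : 1 <= n) :
  #|avoiders2 n pattern132 patternD| = catalan n.-1.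
Proof.
case: n hn => // n _; rewrite -card_avoiders132 /=.
have -> : avoiders2 n.+1 pattern132 patternD
    = [set s : 'S_n.+1 | avoids pattern132 s & s ord_max == ord_max].
  apply/setP => s; rewrite !inE; case: (boolP (avoids pattern132 s)) => //=.
  exact: avoids_132_D_max_last.
rewrite card_lift_perm; apply: eq_card => t.
by rewrite !inE avoids132_lift_max.
Qed.
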